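(* Let $q=p^k$ with $p$ an odd prime. Let $A,B\in\mathbb{F}_q$ with $A\neq 0$, $B\neq0$, $AB-1\neq 0$, $AB+2\neq 0$, $A+B+1\neq 0$, $A^2-AB-A+B^2-B+1\neq 0$ and $A^3+AB+1=0$. Then $$f(x)=x^{q^2-q+1}+Ax^{q^3-q^2+q}+Bx$$ is a permutation polynomial of $\mathbb{F}_{q^3}$.
   Context: A polynomial $f\in\mathbb{F}_{q^3}[x]$ is a permutation polynomial of $\mathbb{F}_{q^3}$ if $c\mapsto f(c)$ is a bijection of $\mathbb{F}_{q^3}$. *)

(* Defs.v *)
From mathcomp Require Import all_boot all_algebra.
Set Implicit Arguments.
Unset Strict Implicit.
Unset Printing Implicit Defensive.
Import GRing.Theory.
Local Open Scope ring_scope.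

Definition permutation_polynomial (L : finFieldType) (f : {poly L}) : Prop :=
  bijective (fun c : L => f.[c]).

(* Main.v *)
Require Import Defs.
From mathcomp Require Import all_boot all_algebra.
From mathcomp Require Import finfield ring.
Set Implicit Arguments.
Unset Strict Implicit.
Unset Printing Implicit Defensive.
Import GRing.Theory.
Local Open Scope ring_scope.

(** Write [s] for the [q]-Frobenius and put [X = x^-1], [Y = s X], [Z = s Y].
    For [x <> 0], [f x * (X * Y * Z) = Y^2 + B Y Z + A Z^2], so up to the factor
    [XYZ], which lies in [F_q], [f] is a quadratic map of the projective plane.
    The relation [A^3 + A B + 1 = 0] says that this quadratic form has the roots
    [A^-1] and [A^2], which makes the map a Cremona transformation: with
    [U = A X - s X] it is, up to scalars in [F_q],
    [U^-1 |-> s (s U^-1) + A U^-1].  Hence [f] is a composition of inversions and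
    [F_q]-linear maps, up to [F_q]-scalars; the linear maps are injective because
    [A^3 <> 1] (from [A B + 2 <> 0]) and [A^3 <> -1] (from [B <> 0]), and the
    scalars are controlled by the homogeneity [f (l x) = l f x] for [l] in
    [F_q]. *)

Section CubicAutomorphism.

Variables (L : fieldType) (s : {rmorphism L -> L}).
Hypothesis s3 : forall x, s (s (s x)) = x.

(** Applying [s] three times multiplies [v] by [c ^+ 3], yet is the identity by [s3]. *)
Lemma eigenvalue_cube (c v : L) : s c = c -> s v = c * v -> v != 0 -> c ^+ 3 = 1.
Proof.
move=> sc sv v0; apply: (mulIf v0).
by rewrite mul1r -[RHS]s3 !(sv, rmorphM, sc) !exprS expr0 mulr1 !mulrA.
Qed.

(** The exponents of [f] written through Frobenius: [q ^ 2 - q + 1] becomes [x * s (s x) / s x], and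
    [x ^+ (q ^ 3) = x] gives the second term. As [0^-1 = 0], the value at 0 is 0. *)
Definition cremona (a b x : L) : L :=
  x * s (s x) / s x + a * (x * s x / s (s x)) + b * x.

Lemma cremonaZ (a b l x : L) : s l = l -> cremona a b (l * x) = l * cremona a b x.
Proof.
move=> sl; have [->|l0] := eqVneq l 0.
  by rewrite /cremona !mul0r !mulr0 !addr0.
have [->|x0] := eqVneq x 0.
  by rewrite /cremona !(mulr0, mul0r, addr0).
rewrite /cremona !(rmorphM, sl) /=; field.
by rewrite !fmorph_eq0 x0 l0.
Qed.

Variables a b : L.
Hypotheses (sa : s a = a) (a0 : a != 0).
Hypotheses (a3 : a ^+ 3 != 1) (a3N : a ^+ 3 != -1).
Hypothesis ab : a ^+ 3 + a * b + 1 = 0.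

Let D (v : L) := a * v - s v.
Let T (v : L) := s (s v) + a * v.

Let D_inj v w : D v = D w -> v = w.
Proof.
move=> Dvw; apply/eqP; rewrite -subr_eq0; apply: contraNT a3 => vw0.
apply/eqP/(eigenvalue_cube sa _ vw0).
by apply/eqP; rewrite eq_sym -subr_eq0 rmorphB /= -(subrr (D w)) -{1}Dvw /D; apply/eqP; ring.
Qed.

Let T_inj v w : T v = T w -> v = w.
Proof.
move=> Tvw; apply/eqP; rewrite -subr_eq0; apply: contraNT a3N => vw0.
have ssu : s (s (v - w)) = - a * (v - w).
  by apply/eqP; rewrite -subr_eq0 !rmorphB /= -(subrr (T w)) -{1}Tvw /T; apply/eqP; ring.
move: (v - w) vw0 ssu => u u0 ssu.
(* [s u] is the fourth iterate of [s] at [u], that is, [s \o s] applied twice. One more [s] then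
   gives [a ^+ 4 = - a]. *)
have su : s u = a ^+ 2 * u.
  by rewrite -[s u]s3 ssu !(rmorphM, rmorphN, sa) ssu; ring.
have := ssu; rewrite su rmorphM rmorphXn /= sa su mulrA => /(mulIf u0) a4.
apply/eqP; apply: (mulfI a0); rewrite mulrN1 -a4; ring.
Qed.

Let D0 : D 0 = 0. Proof. by rewrite /D rmorph0 mulr0 subr0. Qed.
Let T0 : T 0 = 0. Proof. by rewrite /T !rmorph0 mulr0 addr0. Qed.

Let D_neq0 v : v != 0 -> D v != 0.
Proof. by apply: contra_neq => Dv; apply: D_inj; rewrite D0. Qed.

Let T_neq0 v : v != 0 -> T v != 0.
Proof. by apply: contra_neq => Tv; apply: T_inj; rewrite T0. Qed.

Let nm (x : L) := x * s x * s (s x).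

Let s_nm x : s (nm x) = nm x.
Proof. by rewrite /nm !rmorphM /= s3; ring. Qed.

Let nm_neq0 x : x != 0 -> nm x != 0.
Proof. by move=> x0; rewrite /nm !mulf_neq0 ?fmorph_eq0. Qed.

(* The scalar relating [cremona a b x] to [T (D x^-1)^-1]. *)
Let d x := - (nm (D x^-1) * nm x / a).

Let s_d x : s (d x) = d x.
Proof. by rewrite /d rmorphN rmorphM fmorphV sa rmorphM !s_nm. Qed.

Let d_neq0 x : x != 0 -> d x != 0.
Proof.
move=> x0; rewrite oppr_eq0 mulf_neq0 ?invr_eq0 //.
by apply: mulf_neq0; apply: nm_neq0; rewrite ?D_neq0 ?invr_eq0.
Qed.

Let cremonaE x : x != 0 -> cremona a b x = d x * T (D x^-1)^-1.
Proof.
move=> x0; have U0 := D_neq0 (invr_neq0 x0).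
(* The factor [nm (D x^-1)] in [d x] clears the inverses inside [T]. *)
have -> : d x * T (D x^-1)^-1
        = - (nm x / a * (s (D x^-1) * (D x^-1 + a * s (s (D x^-1))))).
  rewrite /d /T !fmorphV /nm; field.
  by rewrite a0 U0 !fmorph_eq0 U0.
have -> : b = - (a ^+ 3 + 1) / a.
  apply: (mulfI a0); rewrite mulrCA divff // mulr1.
  by apply/eqP; rewrite -subr_eq0 -ab; apply/eqP; ring.
(* With [X], [Y], [Z] the conjugates of [x^-1], the product is [(a Y - Z) (a^2 Z - Y)]: the terms in
   [X] cancel. *)
rewrite /cremona /nm /D !(rmorphB, rmorphM, fmorphV, sa, s3) /=; field.
by rewrite a0 !fmorph_eq0 x0.
Qed.

Lemma cremona_neq0 x : x != 0 -> cremona a b x != 0.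
Proof.
move=> x0; rewrite cremonaE // mulf_neq0 ?d_neq0 //.
by rewrite T_neq0 // invr_neq0 // D_neq0 // invr_neq0.
Qed.

Let DZ l v : s l = l -> D (l * v) = l * D v.
Proof. by move=> sl; rewrite /D rmorphM /= sl; ring. Qed.

Let TZ l v : s l = l -> T (l * v) = l * T v.
Proof. by move=> sl; rewrite /T !rmorphM /= !sl; ring. Qed.

Lemma cremona_inj : injective (cremona a b).
Proof.
have f0 : cremona a b 0 = 0 by rewrite /cremona !(mulr0, mul0r, addr0).
move=> x y; have [->|x0] := eqVneq x 0; have [->|y0] := eqVneq y 0 => //.
- by rewrite f0 => /esym/eqP; rewrite (negPf (cremona_neq0 y0)).
- by rewrite f0 => /eqP; rewrite (negPf (cremona_neq0 x0)).
(* Undoing [T], the inversion and [D] determines [x] only up to this [s]-fixed scalar. *)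
move=> fxy; pose l := d x / d y.
have sl : s l = l by rewrite /l rmorphM fmorphV /= !s_d.
have l0 : l != 0 by rewrite mulf_neq0 ?invr_neq0 ?d_neq0.
have slV : s l^-1 = l^-1 by rewrite fmorphV sl.
have /T_inj lU : T (l * (D x^-1)^-1) = T (D y^-1)^-1.
  rewrite TZ //; apply: (mulfI (d_neq0 y0)).
  by rewrite -cremonaE // -fxy cremonaE // /l mulrA mulrCA divff ?mulr1 ?d_neq0.
clearbody l.
have /D_inj lX : D (l^-1 * x^-1) = D y^-1.
  by rewrite DZ // -[RHS]invrK -lU invfM invrK.
have yE : y = l * x by rewrite -[LHS]invrK -lX invfM !invrK.
suff l1 : l = 1 by rewrite yE l1 mul1r.
(* Homogeneity gives [l * cremona a b x = cremona a b x], with a nonzero value to cancel. *)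
apply: (mulIf (cremona_neq0 x0)).
by rewrite mul1r -cremonaZ // -yE.
Qed.

End CubicAutomorphism.

Lemma iter_Frobenius (R : comNzRingType) (p k : nat) : p \in [pchar R] ->
  exists s : {rmorphism R -> R}, forall x, s x = x ^+ (p ^ k).
Proof.
move=> pR; elim: k => [|k [s sE]]; first by exists idfun.
exists (pFrobenius_aut pR \o s) => x /=.
by rewrite pFrobenius_autE sE -exprM expnSr.
Qed.

Theorem theorem3p3 (p k q : nat) (Fq Fq3 : finFieldType)
    (iota : {rmorphism Fq -> Fq3}) (A B : Fq)
    (p_prime : prime p) (p_odd : odd p) (k_gt0 : (0 < k)%N)
    (q_def : q = (p ^ k)%N)
    (card_Fq : #|Fq| = q) (card_Fq3 : #|Fq3| = (q ^ 3)%N)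
    (A_neq0 : A <> 0) (B_neq0 : B <> 0)
    (AB_neq1 : A * B - 1 <> 0) (AB_neqN2 : A * B + 2%:R <> 0)
    (ABD_neq0 : A + B + 1 <> 0)
    (quad_neq0 : A ^+ 2 - A * B - A + B ^+ 2 - B + 1 <> 0)
    (cubic_eq0 : A ^+ 3 + A * B + 1 = 0) :
  permutation_polynomial
    ('X^(q ^ 2 - q + 1)
     + (iota A) *: 'X^(q ^ 3 - q ^ 2 + q)
     + (iota B) *: 'X).
Proof.
have q_gt0 : (0 < q)%N by rewrite q_def expn_gt0 prime_gt0.
have pL : p \in [pchar Fq3].
  by apply: (@card_finPcharP _ p (k * 3)) => //; rewrite card_Fq3 q_def -expnM.
have [s sE] := iter_Frobenius k pL; rewrite -q_def in sE.
have s_iota c : s (iota c) = iota c by rewrite sE -rmorphXn -card_Fq expf_card.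
have s3 x : s (s (s x)) = x.
  by rewrite !sE -!exprM -[RHS]expf_card card_Fq3 !expnS expn0 muln1 mulnA.
(* These bounds make the truncated subtractions in the exponents genuine. *)
have le_q : (q <= q ^ 2)%N by rewrite leq_pmulr.
have le_q2 : (q ^ 2 <= q ^ 3)%N by rewrite leq_pexp2l.
have fE x : ('X^(q ^ 2 - q + 1) + (iota A) *: 'X^(q ^ 3 - q ^ 2 + q)
             + (iota B) *: 'X).[x] = cremona s (iota A) (iota B) x.
  rewrite !hornerE /cremona; have [->|x0] := eqVneq x 0.
    by rewrite !expr0n addn1 addn_eq0 (gtn_eqF q_gt0) andbF !(mulr0, mul0r).
  have sx0 : s x != 0 by rewrite fmorph_eq0.
  have ssx0 : s (s x) != 0 by rewrite fmorph_eq0.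
  have ssE : s (s x) = x ^+ (q ^ 2) by rewrite !sE -exprM.
  have q3E : x ^+ (q ^ 3) = x by rewrite -card_Fq3 expf_card.
  congr (_ + _ * _ + _).
    apply: (mulIf sx0); rewrite divfK // ssE sE -exprD addnAC subnK //.
    by rewrite exprD expr1 mulrC.
  apply: (mulIf ssx0); rewrite divfK // ssE -exprD addnAC subnK //.
  by rewrite exprD q3E sE.
have a3E : A ^+ 3 = - (A * B) - 1.
  by apply/eqP; rewrite -subr_eq0 -cubic_eq0; apply/eqP; ring.
apply: injF_bij => x y; rewrite !fE; apply: cremona_inj => //.
- by rewrite fmorph_eq0; apply/eqP.
- rewrite -rmorphXn -(rmorph1 iota) (inj_eq (fmorph_inj iota)); apply/eqP=> A3.
  apply: AB_neqN2; have -> : A * B + 2%:R = 1 - A ^+ 3 by rewrite a3E; ring.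
  by rewrite A3 subrr.
(* By the cubic relation, [A ^+ 3 = -1] would force [A * B = 0]. *)
- rewrite -rmorphXn -(rmorphN1 iota) (inj_eq (fmorph_inj iota)) a3E.
  by rewrite -subr_eq0 opprK subrK oppr_eq0 mulf_neq0 //; apply/eqP.
- by rewrite -rmorphXn -rmorphM -rmorphD -(rmorph1 iota) -rmorphD cubic_eq0 rmorph0.
Qed.
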